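(* Let $M$ be a set system over a finite set $V$, and let $\varphi$ be any finite sequence of pivot operations $*\{j\}$ and loop complementation operations $+\{j\}$ on elements $j\in V$. Then $M\varphi = M+X*Y+Z$ for some $X,Y,Z\subseteq V$ with $X\subseteq Y$.
   Context: A set system over a finite set $V$ is a pair $M=(V,D)$ with $D$ a family of subsets of $V$. Operations are written postfix and associate to the left: $M\varphi_1\varphi_2\cdots\varphi_n=(\cdots((M\varphi_1)\varphi_2)\cdots)\varphi_n$, and $M+X*Y+Z=((M+X)*Y)+Z$. $\oplus$ denotes symmetric difference of sets (and exclusive-or of truth values). Pivot: for $X\subseteq V$, $M*X=(V,\{Y\oplus X \mid Y\in D\})$. Loop complementation: for $j\in V$, $M+\{j\}=(V,D')$ where for all $Z\subseteq V$: if $j\in Z$, then $Z\in D'$ iff $(Z\in D)\oplus(Z\setminus\{j\}\in D)$; if $j\notin Z$, then $Z\in D'$ iff $Z\in D$. For $X=\{x_1,\dots,x_n\}\subseteq V$, $M+X$ denotes $M+\{x_1\}+\{x_2\}\cdots+\{x_n\}$ (the result does not depend on the order), with $M+\varnothing=M$. *)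

(* Defs.v *)
From mathcomp Require Import all_boot.

Set Implicit Arguments.
Unset Strict Implicit.
Unset Printing Implicit Defensive.

(* A set system (V, D) over the finite ground set V is given by its family D. *)
Definition set_system (V : finType) := {set {set V}}.

Section SetSystem.
Variable V : finType.
Implicit Types (M : set_system V) (X Y Z : {set V}) (j : V).

Definition symdiff (A B : {set V}) : {set V} := (A :\: B) :|: (B :\: A).

Definition pivot M X : set_system V := [set symdiff Y X | Y in M].

Definition loopc1 M j : set_system V :=
  [set Z : {set V} |
     if j \in Z then (Z \in M) (+) (Z :\ j \in M) else Z \in M].

(* The elements of X are processed in the order of enum; loopcE below shows
   that any other duplicate-free enumeration gives the same result. *)
Definition loopc M X : set_system V := foldl loopc1 M (enum X).

Variant operation := PivotAt of V | LoopAt of V.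

Definition apply_op M (o : operation) : set_system V :=
  match o with
  | PivotAt j => pivot M [set j]
  | LoopAt j => loopc1 M j
  end.

Definition apply_ops M (phi : seq operation) : set_system V :=
  foldl apply_op M phi.

Lemma loopc1C M i j : loopc1 (loopc1 M i) j = loopc1 (loopc1 M j) i.
Proof.
have [-> //|ij] := eqVneq i j.
apply/setP => Z; rewrite !inE (negbTE ij) eq_sym (negbTE ij) /=.
have -> : Z :\ j :\ i = Z :\ i :\ j by rewrite !setDDl setUC.
by case: (i \in Z); case: (j \in Z) => //=; rewrite addbACA.
Qed.

Lemma foldl_loopc1C M j s :
  foldl loopc1 (loopc1 M j) s = loopc1 (foldl loopc1 M s) j.
Proof. by elim: s M => //= i s IHs M; rewrite loopc1C IHs. Qed.

Lemma perm_foldl_loopc1 M s t :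
  perm_eq s t -> foldl loopc1 M s = foldl loopc1 M t.
Proof.
elim: s M t => [|j s IHs] M t st; first by rewrite perm_sym in st; rewrite (perm_nilP st).
have jt : j \in t by rewrite -(perm_mem st) mem_head.
case/splitPr: jt st => t1 t2.
rewrite perm_sym perm_catC /= perm_cons perm_catC perm_sym => st.
by rewrite /= (IHs _ _ st) !foldl_cat /= foldl_loopc1C.
Qed.

Lemma loopcE M X (s : seq V) :
  uniq s -> s =i X -> loopc M X = foldl loopc1 M s.
Proof.
move=> us sX; apply: perm_foldl_loopc1.
by apply: uniq_perm => // [|x]; rewrite ?enum_uniq // mem_enum sX.
Qed.

Lemma loopc_set0 M : loopc M set0 = M.
Proof. by rewrite /loopc enum_set0. Qed.

Lemma loopc_set1 M j : loopc M [set j] = loopc1 M j.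
Proof. by rewrite /loopc enum_set1. Qed.

End SetSystem.

Arguments PivotAt {V}.
Arguments LoopAt {V}.

(* Main.v *)
Require Import Defs.
From mathcomp Require Import all_boot.

(* Operations at distinct elements commute, while the two operations at a
   single element j are involutions satisfying the braid relation
   +j*j+j = *j+j*j, so they generate a quotient of S_3.  Its six elements are
   the words +x*y+z with x ==> y.  Hence the j-part of M+X*Y+Z can be moved to
   the end, where a further operation at j is absorbed by a six-case check. *)

Section NormalForm.
Variable V : finType.
Implicit Types (M : set_system V) (X Y Z : {set V}) (j : V).

Lemma in_symdiff X Y x : (x \in symdiff X Y) = (x \in X) (+) (x \in Y).
Proof. by rewrite !inE; case: (x \in X); case: (x \in Y). Qed.

Lemma symdiffA X Y Z : symdiff X (symdiff Y Z) = symdiff (symdiff X Y) Z.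
Proof. by apply/setP => x; rewrite !in_symdiff addbA. Qed.

Lemma symdiffK Y : involutive (fun X => symdiff X Y).
Proof. by move=> X; apply/setP => x; rewrite !in_symdiff addbK. Qed.

Lemma in_pivot M X Z : (Z \in pivot M X) = (symdiff Z X \in M).
Proof.
apply/imsetP/idP => [[Y MY ->]|MZ]; first by rewrite symdiffK.
by exists (symdiff Z X); rewrite ?symdiffK.
Qed.

Lemma pivot_pivot M X Y : pivot (pivot M X) Y = pivot M (symdiff Y X).
Proof. by apply/setP => Z; rewrite !in_pivot symdiffA. Qed.

Lemma pivotK X : involutive (fun M => pivot M X).
Proof. by move=> M; apply/setP => Z; rewrite !in_pivot symdiffK. Qed.

Lemma pivot_setU1 M j Y :
  j \notin Y -> pivot M (j |: Y) = pivot (pivot M Y) [set j].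
Proof.
move=> jY; rewrite pivot_pivot; congr pivot; apply/setP => x.
by rewrite in_symdiff !inE; case: eqVneq => // ->; rewrite (negbTE jY).
Qed.

Lemma in_loopc1 M j Z :
  (Z \in loopc1 M j) = if j \in Z then (Z \in M) (+) (Z :\ j \in M) else Z \in M.
Proof. by rewrite inE. Qed.

Lemma loopc1K j : involutive (fun M => loopc1 M j).
Proof.
move=> M; apply/setP => Z; rewrite !inE eqxx /=.
by case: (j \in Z) => //; rewrite addbK.
Qed.

(** As [j] is outside [Y], taking the symmetric difference with [Y] keeps the membership of [j] and
    commutes with deleting [j]. *)
Lemma pivot_loopc1C M j Y :
  j \notin Y -> pivot (loopc1 M j) Y = loopc1 (pivot M Y) j.
Proof.
move=> jY; apply/setP => Z.
rewrite inE !in_pivot inE in_symdiff (negbTE jY) addbF.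
case: ifP => // _; congr (_ (+) (_ \in M)); apply/setP => x.
by rewrite !(in_symdiff, in_setD1); case: eqVneq => // ->; rewrite (negbTE jY).
Qed.

Lemma loopc_setU1 M j X :
  j \notin X -> loopc M (j |: X) = loopc1 (loopc M X) j.
Proof.
(* The loop complementation at [j] moves from last to first, so that [j :: enum X] serves as an
   enumeration of [j |: X]. *)
move=> jX; rewrite -foldl_loopc1C; apply: (@loopcE _ _ _ (j :: enum X)).
  by rewrite /= mem_enum jX enum_uniq.
by move=> x; rewrite !inE mem_enum.
Qed.

Lemma pivot_loopcC M j X :
  j \notin X -> pivot (loopc M X) [set j] = loopc (pivot M [set j]) X.
Proof.
rewrite -mem_enum /loopc; elim: (enum X) M => //= i s IHs M.
rewrite inE negb_or => /andP[ji js].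
by rewrite IHs // pivot_loopc1C // inE eq_sym.
Qed.

(** For [Z] without [j], let (a, b) be the truth values of membership of [Z] and [j |: Z] in the
    family. Pivoting at [j] swaps a and b, loop complementation replaces b by a + b modulo 2, and
    both sides send (a, b) to (a + b, b). *)
Lemma braid M j :
  pivot (loopc1 (pivot M [set j]) j) [set j]
  = loopc1 (pivot (loopc1 M j) [set j]) j.
Proof.
apply/setP => Z; rewrite !(in_loopc1, in_pivot) in_symdiff set11 addbT.
have [jZ|jZ] := boolP (j \in Z) => /=.
  have -> : symdiff Z [set j] = Z :\ j.
    by apply/setP => x; rewrite in_symdiff !inE; case: eqVneq => [->|_]; rewrite ?jZ ?addbF.
  have -> : symdiff (Z :\ j) [set j] = Z.
    by apply/setP => x; rewrite in_symdiff !inE; case: eqVneq => [->|_]; rewrite ?jZ ?addbF.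
  by rewrite jZ addbC addbK.
have -> : symdiff Z [set j] :\ j = Z.
  apply/setP => x; rewrite in_setD1 in_symdiff !inE.
  by case: eqVneq => [->|_]; rewrite ?(negbTE jZ) //= addbF.
by rewrite symdiffK addbC.
Qed.

Definition ifadd (b : bool) j X := if b then j |: X else X.

(** The word +x*y+z at the single element [j], with Boolean exponents. *)
Definition local_nf M j x y z :=
  let M1 := if x then loopc1 M j else M in
  let M2 := if y then pivot M1 [set j] else M1 in
  if z then loopc1 M2 j else M2.

(** Each operation at [j] commutes with the later ones on [Y] and [Z], which avoid [j], so all of
    them can be pushed to the end in their original order. *)
Lemma normal_form_split M X Y Z j x y z :
    j \notin X -> j \notin Y -> j \notin Z ->
  loopc (pivot (loopc M (ifadd x j X)) (ifadd y j Y)) (ifadd z j Z)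
  = local_nf (loopc (pivot (loopc M X) Y) Z) j x y z.
Proof.
move=> jX jY jZ.
have loopcC N : loopc (loopc1 N j) Z = loopc1 (loopc N Z) j.
  exact: foldl_loopc1C.
rewrite /local_nf /ifadd.
by case: x; case: y; case: z; rewrite ?(loopc_setU1 _ _ _ jX) ?(loopc_setU1 _ _ _ jZ)
  ?(pivot_setU1 _ _ _ jY) ?(pivot_loopc1C _ _ _ jY) -?(pivot_loopcC _ _ _ jZ) ?loopcC.
Qed.

Lemma ifaddD1 j X : ifadd (j \in X) j (X :\ j) = X.
Proof.
apply/setP => x; rewrite /ifadd; case: ifP => jX; rewrite !inE;
  by case: eqVneq => // ->.
Qed.

Lemma loopc1_local_nf M j x y z :
  loopc1 (local_nf M j x y z) j = local_nf M j x y (~~ z).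
Proof. by case: z => //=; rewrite /local_nf loopc1K. Qed.

Lemma pivot_local_nf M j x y z : x ==> y ->
  exists x' y' z', (x' ==> y') /\
    pivot (local_nf M j x y z) [set j] = local_nf M j x' y' z'.
Proof.
rewrite /local_nf; case: x; case: y; case: z => // _.
(* +*+* = *+** = *+ by the braid relation. *)
- by exists false, true, true; rewrite -braid pivotK.
(* +** = +, recorded as the final loop complementation because [x'] may be true only with [y']. *)
- by exists false, false, true; rewrite pivotK.
- by exists true, true, true; rewrite braid.
- by exists false, false, false; rewrite pivotK.
- by exists true, true, false.
- by exists false, true, false.
Qed.

Lemma apply_op_normal_form M X Y Z (o : operation V) : X \subset Y ->
  exists X' Y' Z' : {set V},
    X' \subset Y' /\
    apply_op (loopc (pivot (loopc M X) Y) Z) o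
    = loopc (pivot (loopc M X') Y') Z'.
Proof.
move=> sXY; pose j := match o with PivotAt i => i | LoopAt i => i end.
(* [N] is the normal form with every operation at [j] stripped; the membership bits of [j] in [X],
   [Y], [Z] restore them as a local word. *)
pose N := loopc (pivot (loopc M (X :\ j)) (Y :\ j)) (Z :\ j).
have splitN x y z := normal_form_split M _ _ _ j x y z
  (negbT (setD11 j X)) (negbT (setD11 j Y)) (negbT (setD11 j Z)).
have xy : (j \in X) ==> (j \in Y) by apply/implyP/(subsetP sXY).
have [x' [y' [z' [xy' opN]]]] : exists x' y' z', (x' ==> y') /\
    apply_op (local_nf N j (j \in X) (j \in Y) (j \in Z)) o
    = local_nf N j x' y' z'.
  move: N xy {splitN}; rewrite {}/j; case: o => i N xy.
    exact: pivot_local_nf.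
  by exists (i \in X), (i \in Y), (~~ (i \in Z)); rewrite /= loopc1_local_nf.
exists (ifadd x' j (X :\ j)), (ifadd y' j (Y :\ j)), (ifadd z' j (Z :\ j)).
split; last by rewrite splitN -opN -splitN !ifaddD1.
rewrite /ifadd; case: x' y' xy' {opN} => [] [] // _; rewrite ?setUS ?setSD //.
(* The remaining case has [x'] false and [y'] true: only the larger set receives [j]. *)
exact: subset_trans (setSD _ sXY) (subsetUr _ _).
Qed.

End NormalForm.

Theorem theorem12 (V : finType) (M : set_system V) (phi : seq (operation V)) :
  exists X Y Z : {set V},
    X \subset Y /\ apply_ops M phi = loopc (pivot (loopc M X) Y) Z.
Proof.
(* Induction from the right end, since the last operation of [phi] acts on the normal form already
   reached. *)
elim/last_ind: phi => [|phi o [X [Y [Z [sXY IHphi]]]]].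
  exists set0, set0, set0; split=> //; rewrite !loopc_set0.
  apply/setP => Z; rewrite in_pivot; congr (_ \in M).
  by apply/setP => x; rewrite in_symdiff inE addbF.
by rewrite /apply_ops foldl_rcons -/(apply_ops M phi) IHphi; apply: apply_op_normal_form.
Qed.
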